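(* Let $q>1$ be real, let $n\ge 1$ be an integer, and let $\omega\neq 0$ be a real constant. Then the $n$ functions $$x_k(t)=t^{k-1}\,\frac{d^{k-1}}{dt^{k-1}}\,e_q(-\omega t),\qquad k=1,2,\dots,n,$$ are linearly independent solutions of the $q$-difference equation $$(D_q+\omega)^n x(t)=0 .$$
   Context: For real $q>1$, the Jackson $q$-derivative of a function $x$ is $D_q x(t)=\dfrac{x(qt)-x(t)}{(q-1)t}$ for $t\ne 0$; equations involving $D_q$ are understood for $t\neq 0$. The operator $(D_q+\omega)^n$ is the $n$-fold composition of $x\mapsto D_q x+\omega x$. The $q$-numbers are $[j]_q=1+q+\dots+q^{j-1}$, with $[j]_q!=[1]_q[2]_q\cdots[j]_q$ and $[0]_q!=1$. The Jackson $q$-exponential is $e_q(t)=\sum_{j=0}^\infty \dfrac{t^j}{[j]_q!}$, which is an entire function for $q>1$. In $x_k$ the ordinary derivative $d^{k-1}/dt^{k-1}$ is applied to the function $t\mapsto e_q(-\omega t)$ (so $x_1(t)=e_q(-\omega t)$). *)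

(* Defs.v *)
From Stdlib Require Import Reals.
From Coquelicot Require Import Coquelicot.
Open Scope R_scope.

(* The value of [Dq q x] at 0 is a meaningless division by 0. It never affects
   the values of the iterates of [Dq_plus q omega] away from 0, because
   [q * t <> 0] when [q > 1] and [t <> 0]. *)
Definition Dq (q : R) (x : R -> R) (t : R) : R :=
  (x (q * t) - x t) / ((q - 1) * t).

Definition Dq_plus (q omega : R) (x : R -> R) (t : R) : R :=
  Dq q x t + omega * x t.

Fixpoint qnum (q : R) (j : nat) : R :=
  match j with
  | O => 0
  | S i => qnum q i + q ^ i
  end.

Fixpoint qfact (q : R) (j : nat) : R :=
  match j with
  | O => 1
  | S i => qfact q i * qnum q (S i)
  end.

Definition qexp (q t : R) : R := PSeries (fun j => / qfact q j) t.

Definition xsol (q omega : R) (k : nat) (t : R) : R :=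
  t ^ (k - 1) * Derive_n (fun s => qexp q (- omega * s)) (k - 1) t.

Definition is_solution (q omega : R) (n : nat) (x : R -> R) : Prop :=
  forall t : R, t <> 0 -> Nat.iter n (Dq_plus q omega) x t = 0.

(* Linear independence over R of f 1, ..., f n as functions on R \ {0}, the
   domain on which the q-difference equation is posed. *)
Definition lin_indep (n : nat) (f : nat -> R -> R) : Prop :=
  forall c : nat -> R,
    (forall t : R, t <> 0 -> sum_n_m (fun k => c k * f k t) 1 n = 0) ->
    forall k : nat, (1 <= k <= n)%nat -> c k = 0.

(* Main.v *)
Require Import Defs.
From Stdlib Require Import Reals Lra Lia.
From Coquelicot Require Import Coquelicot.
Open Scope R_scope.

(** Put L = D_q + omega and f(t) = e_q(-omega t). Everything rests on the
    lowering relation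

      L x_(k+1) = - omega k x_k    on t <> 0      ([Dq_plus_xsol]),

    which makes the x_k a Jordan chain of L, up to nonzero factors, with
    L x_1 = 0.

    The relation comes from the functional equation of the q-exponential,
    f(q t) = (1 - (q - 1) omega t) f(t) ([qexp_dilation]), which says
    L f = 0. Since the factor of f on the right is affine in t, differentiating
    k times produces just one extra term ([Derive_n_dilation]):

      q^k f^(k)(q t) = (1 - (q - 1) omega t) f^(k)(t)
                       - k (q - 1) omega f^(k-1)(t),

    and multiplication by t^k turns q^k f^(k)(q t) into x_(k+1)(q t).

    Applying L repeatedly lowers x_k to x_1 and then kills it, so that
    L^n x_k = 0 for k <= n. For independence, L turns a linear relation among
    x_1, ..., x_(n+1), with coefficients c_k, into one among x_1, ..., x_n whose
    coefficients are c_2, ..., c_(n+1) times nonzero factors; these vanish by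
    induction, and then c_1 = 0 because e_q is not identically zero. *)

(** * The q-exponential *)

Lemma qnum_ge (q : R) (j : nat) : 1 < q -> INR j <= qnum q j.
Proof.
  intros hq; induction j as [|j IH]; [simpl; lra|].
  rewrite S_INR; simpl qnum.
  pose proof (pow_R1_Rle q j (Rlt_le _ _ hq)); lra.
Qed.

Lemma qnum_S_pos (q : R) (j : nat) : 1 < q -> 0 < qnum q (S j).
Proof.
  intros hq; pose proof (qnum_ge q (S j) hq) as H.
  rewrite S_INR in H; pose proof (pos_INR j); lra.
Qed.

Lemma qfact_pos (q : R) (j : nat) : 1 < q -> 0 < qfact q j.
Proof.
  intros hq; induction j as [|j IH]; [simpl; lra|].
  change (0 < qfact q j * qnum q (S j)).
  apply Rmult_lt_0_compat; [exact IH | now apply qnum_S_pos].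
Qed.

Lemma qnum_geometric (q : R) (j : nat) : (q - 1) * qnum q j = q ^ j - 1.
Proof. induction j as [|j IH]; simpl; [ring | rewrite Rmult_plus_distr_l, IH; ring]. Qed.

(** The ratio of consecutive coefficients is 1 / [j+1]_q, at most
    1 / (j + 1). *)
Lemma CV_radius_qexp (q : R) :
  1 < q -> CV_radius (fun j => / qfact q j) = p_infty.
Proof.
  intros hq; apply CV_radius_infinite_DAlembert.
  - intros j; apply Rinv_neq_0_compat, Rgt_not_eq, qfact_pos, hq.
  - apply is_lim_seq_le_le with (u := fun _ => 0) (w := fun j => / INR (S j)).
    + intros j; split; [apply Rabs_pos|].
      pose proof (qfact_pos q j hq) as Hf.
      pose proof (qnum_S_pos q j hq) as Hn.
      replace (/ qfact q (S j) / / qfact q j) with (/ qnum q (S j)).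
      * rewrite Rabs_pos_eq by (left; now apply Rinv_0_lt_compat).
        apply Rinv_le_contravar; [apply lt_0_INR; lia | now apply qnum_ge].
      * change (qfact q (S j)) with (qfact q j * qnum q (S j)).
        field; lra.
    + apply is_lim_seq_const.
    + replace (Finite 0) with (Rbar_inv p_infty) by reflexivity.
      apply is_lim_seq_inv; [|discriminate].
      apply (is_lim_seq_incr_1 INR), is_lim_seq_INR.
Qed.

Lemma ex_pseries_qexp (q t : R) :
  1 < q -> ex_pseries (fun j => / qfact q j) t.
Proof.
  intros hq; apply CV_radius_inside; rewrite CV_radius_qexp by exact hq.
  exact I.
Qed.

Lemma ex_derive_n_qexp (q t : R) (k : nat) :
  1 < q -> ex_derive_n (qexp q) k t.
Proof.
  intros hq; apply (ex_derive_n_PSeries k (fun j => / qfact q j)).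
  rewrite CV_radius_qexp by exact hq.
  exact I.
Qed.

Lemma qexp_1_pos (q : R) : 1 < q -> 0 < qexp q 1.
Proof.
  intros hq; unfold qexp.
  rewrite PSeries_decr_1 by now apply ex_pseries_qexp.
  assert (H : 0 <= PSeries (PS_decr_1 (fun j => / qfact q j)) 1).
  { unfold PSeries.
    rewrite <- (Rmult_0_l (Series (fun _ => 0))), <- Series_scal_l.
    apply Series_le.
    - intros j; rewrite Rmult_0_l, pow1, Rmult_1_r; split; [lra|].
      left; apply Rinv_0_lt_compat, qfact_pos, hq.
    - apply ex_pseries_R.
      apply ex_pseries_decr_1; [|now apply ex_pseries_qexp].
      right; exists 1; apply Rmult_1_l. }
  simpl qfact; lra.
Qed.

(** Comparing coefficients, this is
    q^(j+1) / [j+1]_q! = 1 / [j+1]_q! + (q - 1) / [j]_q!. *)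
Lemma qexp_dilation (q u : R) :
  1 < q -> qexp q (q * u) = (1 + (q - 1) * u) * qexp q u.
Proof.
  intros hq; unfold qexp; set (a := fun j => / qfact q j).
  pose proof (ex_pseries_qexp q u hq) as Ha; fold a in Ha.
  transitivity (PSeries (PS_plus a (PS_scal (q - 1) (PS_incr_1 a))) u).
  - apply Series_ext; intros j.
    rewrite Rpow_mult_distr, <- Rmult_assoc; f_equal.
    unfold PS_plus, PS_scal, PS_incr_1, a.
    destruct j as [|j]; [unfold plus, scal, zero; simpl; unfold mult; simpl; lra|].
    pose proof (qfact_pos q j hq) as Hf.
    pose proof (qnum_S_pos q j hq) as Hn.
    change (qfact q (S j)) with (qfact q j * qnum q (S j)).
    change (/ (qfact q j * qnum q (S j)) * q ^ S j
            = / (qfact q j * qnum q (S j)) + (q - 1) * / qfact q j).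
    replace (q ^ S j) with (1 + (q - 1) * qnum q (S j))
      by (rewrite qnum_geometric; ring).
    field; lra.
  - rewrite PSeries_plus, PSeries_scal, PSeries_incr_1; [ring|exact Ha|].
    apply ex_pseries_scal; [apply Rmult_comm|].
    now apply ex_pseries_incr_1.
Qed.

(** * The lowering relation *)

Lemma ex_derive_Derive_n_qexp_scal (q a t : R) (k : nat) :
  1 < q -> ex_derive (Derive_n (fun s => qexp q (a * s)) k) t.
Proof.
  intros hq; apply (ex_derive_n_comp_scal (qexp q) a (S k) t).
  apply filter_forall; intros; now apply ex_derive_n_qexp.
Qed.

(** The Leibniz rule with an affine factor: only its first derivative
    contributes. For k = 0 the junk index [k - 1 = 0] has coefficient
    [INR 0]. *)
Lemma Derive_n_dilation (q omega : R) (k : nat) (t : R) :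
  1 < q ->
  let f := fun s => qexp q (- omega * s) in
  q ^ k * Derive_n f k (q * t)
  = (1 - (q - 1) * omega * t) * Derive_n f k t
    - INR k * (q - 1) * omega * Derive_n f (k - 1) t.
Proof.
  intros hq f; revert t.
  assert (Hex : forall j s, ex_derive (Derive_n f j) s)
    by (intros j s; now apply ex_derive_Derive_n_qexp_scal).
  induction k as [|k IH]; intros t.
  - simpl Derive_n; unfold f.
    replace (- omega * (q * t)) with (q * (- omega * t)) by ring.
    rewrite qexp_dilation by exact hq; simpl; ring.
  - assert (Hl : is_derive (fun s => q ^ k * Derive_n f k (q * s)) t
                   (q ^ S k * Derive_n f (S k) (q * t))).
    { auto_derive; [apply Hex|].
      change (q ^ k * (q * 1 * Derive_n f (S k) (q * t))
              = q ^ S k * Derive_n f (S k) (q * t)); simpl pow; ring. }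
    assert (Hr : is_derive
                   (fun s => (1 - (q - 1) * omega * s) * Derive_n f k s
                             - INR k * (q - 1) * omega * Derive_n f (k - 1) s) t
                   ((1 - (q - 1) * omega * t) * Derive_n f (S k) t
                    - (q - 1) * omega * Derive_n f k t
                    - INR k * (q - 1) * omega * Derive_n f (S (k - 1)) t)).
    { auto_derive; [repeat split; apply Hex|].
      change (Derive (fun s => Derive_n f ?j s) t) with (Derive_n f (S j) t); ring. }
    apply (is_derive_ext _ _ _ _ IH) in Hl.
    rewrite (eq_trans (eq_sym (is_derive_unique _ _ _ Hl)) (is_derive_unique _ _ _ Hr)).
    rewrite S_INR; replace (S k - 1)%nat with k by lia.
    destruct k as [|k]; [simpl INR; ring|].
    replace (S (S k - 1)) with (S k) by lia; ring.
Qed.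

(** For k = 0 this reads L x_1 = 0: truncated subtraction makes [xsol q omega 0]
    a copy of [xsol q omega 1], but its coefficient is zero. *)
Lemma Dq_plus_xsol (q omega : R) (k : nat) (t : R) :
  1 < q -> t <> 0 ->
  Dq_plus q omega (xsol q omega (S k)) t = - omega * INR k * xsol q omega k t.
Proof.
  intros hq ht; unfold Dq_plus, Dq, xsol.
  replace (S k - 1)%nat with k by lia.
  rewrite Rpow_mult_distr.
  pose proof (Derive_n_dilation q omega k t hq) as H; cbv zeta in H.
  set (f := fun s => qexp q (- omega * s)) in *.
  replace (q ^ k * t ^ k * Derive_n f k (q * t))
    with (t ^ k * (q ^ k * Derive_n f k (q * t))) by ring.
  rewrite H.
  destruct k as [|k]; [simpl INR; field; lra|].
  replace (S k - 1)%nat with k by lia.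
  simpl pow; field; lra.
Qed.

(** * Iterates of the operator *)

(** Away from 0, the operator sees its argument only away from 0, as q t <> 0;
    its junk value at 0 thus never propagates. *)
Lemma Dq_plus_ext (q omega : R) (x y : R -> R) :
  1 < q -> (forall t, t <> 0 -> x t = y t) ->
  forall t, t <> 0 -> Dq_plus q omega x t = Dq_plus q omega y t.
Proof.
  intros hq H t ht; unfold Dq_plus, Dq.
  rewrite !H; [reflexivity | exact ht|].
  apply Rmult_integral_contrapositive; split; lra.
Qed.

Lemma iter_Dq_plus_ext (q omega : R) (n : nat) (x y : R -> R) :
  1 < q -> (forall t, t <> 0 -> x t = y t) ->
  forall t, t <> 0 ->
  Nat.iter n (Dq_plus q omega) x t = Nat.iter n (Dq_plus q omega) y t.
Proof.
  intros hq H; induction n as [|n IH]; [exact H|].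
  exact (Dq_plus_ext q omega _ _ hq IH).
Qed.

Lemma iter_Dq_plus_scal (q omega c : R) (n : nat) (x : R -> R) :
  1 < q -> forall t, t <> 0 ->
  Nat.iter n (Dq_plus q omega) (fun s => c * x s) t
  = c * Nat.iter n (Dq_plus q omega) x t.
Proof.
  intros hq; induction n as [|n IH]; intros t ht; [reflexivity|].
  rewrite !Nat.iter_succ.
  rewrite (Dq_plus_ext q omega _ _ hq IH t ht).
  unfold Dq_plus, Dq; field; lra.
Qed.

Lemma Dq_plus_sum (q omega : R) (m : nat) (c : nat -> R) (x : nat -> R -> R) (t : R) :
  Dq_plus q omega (fun s => sum_n_m (fun k => c k * x k s) 1 m) t
  = sum_n_m (fun k => c k * Dq_plus q omega (x k) t) 1 m.
Proof.
  induction m as [|m IH].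
  - rewrite sum_n_m_zero by lia.
    unfold Dq_plus, Dq; rewrite !sum_n_m_zero by lia.
    change ((0 - 0) / ((q - 1) * t) + omega * 0 = 0); unfold Rdiv; ring.
  - rewrite sum_n_Sm, <- IH by lia.
    unfold Dq_plus, Dq; rewrite !sum_n_Sm by lia.
    unfold plus; simpl; unfold Rdiv; ring.
Qed.

Lemma xsol_is_solution (q omega : R) (n k : nat) :
  1 < q -> (1 <= k <= n)%nat -> is_solution q omega n (xsol q omega k).
Proof.
  intros hq; revert k; induction n as [|n IH]; intros k hk t ht; [lia|].
  destruct k as [|k]; [lia|].
  rewrite Nat.iter_succ_r.
  rewrite (iter_Dq_plus_ext q omega n _ (fun s => - omega * INR k * xsol q omega k s) hq)
    by (try exact ht; intros s hs; now apply Dq_plus_xsol).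
  rewrite iter_Dq_plus_scal by assumption.
  destruct k as [|k]; [simpl INR; ring|].
  rewrite (IH (S k)) by (lia || exact ht); ring.
Qed.

(** * Linear independence *)

Lemma xsol_lin_indep (q omega : R) (n : nat) :
  1 < q -> omega <> 0 -> lin_indep n (xsol q omega).
Proof.
  intros hq homega; induction n as [|n IH]; intros c Hc; [intros; lia|].
  assert (Hhigh : forall j, (1 <= j <= n)%nat -> c (S j) = 0).
  { assert (Hrel : forall j, (1 <= j <= n)%nat -> c (S j) * (- omega * INR j) = 0).
    { apply (IH (fun j => c (S j) * (- omega * INR j))); intros t ht.
      assert (HL : sum_n_m (fun k => c k * Dq_plus q omega (xsol q omega k) t) 1 (S n)
                    = 0 :> R).
      { rewrite <- Dq_plus_sum.
        rewrite (Dq_plus_ext q omega _ (fun _ => 0) hq Hc t ht).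
        unfold Dq_plus, Dq, Rdiv; ring. }
      rewrite sum_Sn_m, Dq_plus_xsol, <- sum_n_m_S in HL by (lia || assumption).
      rewrite (sum_n_m_ext_loc _
                 (fun j => c (S j) * (- omega * INR j) * xsol q omega j t)) in HL
        by (intros j _; rewrite Dq_plus_xsol by assumption; symmetry; apply Rmult_assoc).
      replace (c 1%nat * (- omega * INR 0 * xsol q omega 0 t)) with (@zero R_AbelianMonoid)
        in HL by (change (0 = c 1%nat * (- omega * 0 * xsol q omega 0 t)); ring).
      now rewrite plus_zero_l in HL. }
    intros j hj.
    destruct (Rmult_integral _ _ (Hrel j hj)) as [H|H]; [exact H|exfalso].
    assert (INR j <> 0) by (apply not_0_INR; lia).
    apply Rmult_integral in H; lra. }
  assert (Hone : c 1%nat = 0).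
  { (* At t = - 1 / omega, x_1 takes the value e_q(1) > 0. *)
    assert (ht : - / omega <> 0).
    { pose proof (Rinv_neq_0_compat _ homega); lra. }
    pose proof (Hc _ ht) as H.
    rewrite sum_Sn_m, <- sum_n_m_S in H by lia.
    rewrite (sum_n_m_ext_loc _ (fun _ => zero)) in H
      by (intros j hj; rewrite Hhigh by exact hj; apply Rmult_0_l).
    rewrite sum_n_m_const_zero, plus_zero_r in H.
    unfold xsol in H; simpl in H.
    replace (- omega * - / omega) with 1 in H by (field; exact homega).
    pose proof (qexp_1_pos q hq).
    apply Rmult_integral in H; lra. }
  intros [|[|j]] hk; [lia | exact Hone | apply Hhigh; lia].
Qed.

Theorem mainTheorem1 (q omega : R) (n : nat)
    (hq : 1 < q) (hn : (1 <= n)%nat) (homega : omega <> 0) :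
  (forall k : nat, (1 <= k <= n)%nat -> is_solution q omega n (xsol q omega k)) /\
  lin_indep n (xsol q omega).
Proof.
  split.
  - intros k hk; now apply xsol_is_solution.
  - now apply xsol_lin_indep.
Qed.
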